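(* Gandy's superjump $\mathbb{S}$ is computable, by a term in Gödel's $T$, in any functional $\Xi$ satisfying $\mathsf{LIN}(\Xi)$ together with Feferman's $\mu$.
   Context: The metatheory is $\mathsf{ZFC}$; all functionals live in the full finite type hierarchy. Type $0$ is $\mathbb{N}$, type $1$ is $\mathbb{N}^{\mathbb{N}}$, type $2$ consists of the functionals $\mathbb{N}^{\mathbb{N}}\to\mathbb{N}$. Gödel's $T$ is the class of terms for higher-order primitive recursive functionals, built by $\lambda$-abstraction, application, zero, successor and the recursors $\mathbf{R}_\rho$ for all finite types $\rho$; that a functional is computable in $\Xi$ and $\mu$ by a term in Gödel's $T$ means that it equals $t(\Xi,\mu)$ for some closed term $t$ of Gödel's $T$. The superjump is $\mathbb{S}(F^2,e^0)=0$ if $\{e\}(F)$ terminates, and $=1$ otherwise, where $\{e\}(F)$ is the computation with Kleene S1–S9 index $e$ and input $F$. Feferman's $\mu^2$ satisfies $(\forall f^1)\big[(\exists n)(f(n)=0)\to f(\mu(f))=0\big]$. Write $\overline{g}n=\langle g(0),\dots,g(n-1)\rangle$, and let $[\sigma]$ be the set of all $g\in\mathbb{N}^{\mathbb{N}}$ extending the finite sequence $\sigma$. For $\Xi^{2\to(0\to1)}$ (assigning to each type-$2$ functional a sequence of elements of $\mathbb{N}^{\mathbb{N}}$), $\mathsf{LIN}(\Xi)$ is the statement $(\forall\Psi^2)(\forall g^1)(\exists n^0)\big(g\in\big[\overline{\Xi(\Psi)(n)}\,\Psi(\Xi(\Psi)(n))\big]\big)$. *)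

(* Defs.v *)
From mathcomp Require Import all_boot.
From mathcomp Require Import boolp.

Set Implicit Arguments.
Unset Strict Implicit.
Unset Printing Implicit Defensive.

(** * Finite types and the full type hierarchy *)

Inductive ty : Set :=
  | Nat : ty
  | Arr : ty -> ty -> ty.

Declare Scope ty_scope.
Delimit Scope ty_scope with ty.
Bind Scope ty_scope with ty.
Notation "r ~> s" := (Arr r s) (at level 60, right associativity) : ty_scope.

Fixpoint sem (r : ty) : Type :=
  match r with
  | Nat => nat
  | Arr r s => sem r -> sem s
  end.

(** Pure types: type 0 is N, type k+1 is type k -> N. *)
Fixpoint pure (k : nat) : ty :=
  if k is k'.+1 then (pure k' ~> Nat)%ty else Nat.

(** * Goedel's T: intrinsically typed terms, with de Bruijn variables *)

Inductive var : seq ty -> ty -> Type :=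
  | VZ G r : var (r :: G) r
  | VS G r s : var G r -> var (s :: G) r.

Inductive term : seq ty -> ty -> Type :=
  | Var G r : var G r -> term G r
  | Lam G r s : term (r :: G) s -> term G (r ~> s)
  | App G r s : term G (r ~> s) -> term G r -> term G s
  | Zero G : term G Nat
  | Succ G : term G (Nat ~> Nat)
  | Rec G r : term G (r ~> (Nat ~> r ~> r) ~> Nat ~> r).

Fixpoint env (G : seq ty) : Type :=
  if G is r :: G' then (sem r * env G')%type else unit.

Fixpoint lookup G r (v : var G r) : env G -> sem r :=
  match v in var G r return env G -> sem r with
  | VZ _ _ => fun h => h.1
  | VS _ _ _ v' => fun h => lookup v' h.2
  end.

(** The recursor satisfies R x f 0 = x and R x f (n+1) = f n (R x f n). *)
Fixpoint eval G r (t : term G r) : env G -> sem r :=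
  match t in term G r return env G -> sem r with
  | Var _ _ v => lookup v
  | Lam _ _ _ b => fun h x => eval b (x, h)
  | App _ _ _ a b => fun h => eval a h (eval b h)
  | Zero _ => fun _ => 0
  | Succ _ => fun _ => S
  | Rec _ r => fun _ x f n => nat_rect (fun=> sem r) x f n
  end.

Definition eval0 r (t : term [::] r) : sem r := eval t tt.

Definition T_computable_in (r s u : ty) (Z : sem u) (X : sem r) (Y : sem s) :
    Prop :=
  exists t : term [::] (r ~> s ~> u), Z = eval0 t X Y.

(** * Kleene's S1-S9 *)

(** An argument of a computation: an object of some pure type. *)
Inductive arg : Type := Arg (k : nat) of sem (pure k).

Notation "<< n1 , .. , nk >>" := (CodeSeq.code (cons n1 .. (cons nk nil) ..))
  (at level 0, only parsing).

(** [kleene e Phi a] is {e}(Phi) = a. In S6, [p] lists the values of a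
    permutation of the positions of the arguments; the default of [nth] is never
    used. In S8, the totality of [fun x => {d}(Phi, x, Psi)] is
    witnessed by [G]. In S9, the index is applied to the first [m] of the
    remaining arguments. *)
Inductive kleene : nat -> seq arg -> nat -> Prop :=
  | S1 x Phi : kleene << 1 >> (@Arg 0 x :: Phi) x.+1
  | S2 q Phi : kleene << 2, q >> Phi q
  | S3 x Phi : kleene << 3 >> (@Arg 0 x :: Phi) x
  | S4 d0 d1 Phi b a :
      kleene d1 Phi b -> kleene d0 (@Arg 0 b :: Phi) a ->
      kleene << 4, d0, d1 >> Phi a
  | S5_0 d0 d1 Phi a :
      kleene d0 Phi a -> kleene << 5, d0, d1 >> (@Arg 0 0 :: Phi) a
  | S5_S d0 d1 x Phi b a :
      kleene << 5, d0, d1 >> (@Arg 0 x :: Phi) b ->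
      kleene d1 (@Arg 0 x :: @Arg 0 b :: Phi) a ->
      kleene << 5, d0, d1 >> (@Arg 0 x.+1 :: Phi) a
  | S6 d p Phi a :
      perm_eq p (iota 0 (size Phi)) ->
      kleene d [seq nth (@Arg 0 0) Phi i | i <- p] a ->
      kleene << 6, d, CodeSeq.code p >> Phi a
  | S7 (f : sem (pure 1)) (x : nat) Phi :
      kleene << 7 >> (@Arg 1 f :: @Arg 0 x :: Phi) (f x)
  | S8 k d (Phi : sem (pure k.+2)) (G : sem (pure k.+1)) Psi :
      (forall x : sem (pure k), kleene d (Arg Phi :: Arg x :: Psi) (G x)) ->
      kleene << 8, d >> (Arg Phi :: Psi) (Phi G)
  | S9 x m Phi a :
      m <= size Phi ->
      kleene x (take m Phi) a ->
      kleene << 9, m >> (@Arg 0 x :: Phi) a.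

(** {e}(F) terminates, for F of type 2. *)
Definition terminates (e : nat) (F : sem (pure 2)) : Prop :=
  exists a, kleene e [:: @Arg 2 F] a.

Definition superjump : sem (pure 2 ~> Nat ~> Nat) :=
  fun F e => if `[< terminates e F >] then 0 else 1.

(** * Feferman's mu and LIN *)

Definition feferman_mu (mu : sem (pure 2)) : Prop :=
  forall f : nat -> nat, (exists n, f n = 0) -> f (mu f) = 0.

(** [nbhd s g]: the function g extends the finite sequence s. *)
Definition nbhd (s : seq nat) (g : nat -> nat) : Prop := mkseq g (size s) = s.

Definition LIN (Xi : sem (pure 2 ~> Nat ~> pure 1)) : Prop :=
  forall (Psi : sem (pure 2)) (g : nat -> nat),
    exists n : nat, nbhd (mkseq (Xi Psi n) (Psi (Xi Psi n))) g.

(* Main.v *)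
(* A computation from [F] of type 2 only ever sees [F] and numbers, so a state
   can be coded by a number and the terminating computations from [F] form the
   least fixed point K of an operator on partial functions f from N to N. Call
   a state unfounded for f if it starts an infinite path through the
   subcomputations that f prescribes, where a state at which f is not correct
   may also loop. The paths form a closed set with an obvious modulus, so one
   application of [Xi] decides whether there is one: a path can only be covered
   by a path. If f differs from K, then an error of f, i.e. a state at which f
   and K really differ, can be chosen from f with [mu]: either f is wrong at a
   state all of whose subcomputations are founded, or failing that f is defined
   at an unfounded state. Hence {K} is a closed set with a modulus computable
   from F, and a second application of [Xi] finds K. *)
Require Import Defs.
From mathcomp Require Import all_boot.
From mathcomp Require Import boolp.

Set Implicit Arguments.
Unset Strict Implicit.
Unset Printing Implicit Defensive.

Local Notation dec := CodeSeq.decode.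

(** * Computations as a least fixed point *)

Definition ccons (x s : nat) : nat := CodeSeq.code (x :: dec s).

(** The arithmetical form of the pairing, from which a term for [ccons] is built later. *)
Lemma cconsE x s : ccons x s = 2 ^ x * (s + s).+1.
Proof. by rewrite /ccons /= CodeSeq.decodeK addnn. Qed.

Lemma dec_ccons x s : dec (ccons x s) = x :: dec s.
Proof. exact: CodeSeq.codeK. Qed.

Lemma ccons_code x s : ccons x (CodeSeq.code s) = CodeSeq.code (x :: s).
Proof. by rewrite /ccons CodeSeq.codeK. Qed.

Lemma ccons_inj x s y t : ccons x s = ccons y t -> x = y /\ s = t.
Proof.
move=> /(congr1 CodeSeq.decode); rewrite !dec_ccons => -[-> e]; split=> //.
exact: (can_inj CodeSeq.decodeK).
Qed.

Lemma ccons_neq0 x s : ccons x s <> 0.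
Proof. by move=> /(congr1 CodeSeq.decode); rewrite dec_ccons. Qed.

Definition permuted (p phi phi' : nat) : Prop :=
  perm_eq (dec p) (iota 0 (size (dec phi))) /\
  dec phi' = [seq nth 0 (dec phi) i | i <- dec p].

Definition truncated (m phi phi' : nat) : Prop :=
  m <= size (dec phi) /\ dec phi' = take m (dec phi).

(* A state [c] consists of an index and of a list of arguments in which [x.+1]
   codes the number [x] and [0] codes [F]. The kind [k] tells how the value of
   [c] is obtained: it is [p] (k = 0); it is the value of [p] (k = 1); [p] has
   value [b] and [c] has the value of [q] (k = 2); it is [F] of the values of the
   states [family p q x] (k = 3). *)
Definition rule (c k p b q : nat) : Prop :=
  (exists x phi, [/\ c = ccons (ccons 1 0) (ccons x.+1 phi), k = 0, p = x.+1 & q = 0]) \/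
  (exists x phi, [/\ c = ccons (ccons 2 (ccons x 0)) phi, k = 0, p = x & q = 0]) \/
  (exists x phi, [/\ c = ccons (ccons 3 0) (ccons x.+1 phi), k = 0, p = x & q = 0]) \/
  (exists d0 d1 phi, [/\ c = ccons (ccons 5 (ccons d0 (ccons d1 0))) (ccons 1 phi), k = 1,
     p = ccons d0 phi & q = 0]) \/
  (exists d s phi phi', [/\ c = ccons (ccons 6 (ccons d (ccons s 0))) phi, k = 1,
     permuted s phi phi', p = ccons d phi' & q = 0]) \/
  (exists x m phi phi', [/\ c = ccons (ccons 9 (ccons m 0)) (ccons x.+1 phi), k = 1,
     truncated m phi phi', p = ccons x phi' & q = 0]) \/
  (exists d0 d1 phi, [/\ c = ccons (ccons 4 (ccons d0 (ccons d1 0))) phi, k = 2,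
     p = ccons d1 phi & q = ccons d0 (ccons b.+1 phi)]) \/
  (exists d0 d1 x phi,
    [/\ c = ccons (ccons 5 (ccons d0 (ccons d1 0))) (ccons x.+2 phi), k = 2,
     p = ccons (ccons 5 (ccons d0 (ccons d1 0))) (ccons x.+1 phi) &
     q = ccons d1 (ccons x.+1 (ccons b.+1 phi))]) \/
  (exists d phi, [/\ c = ccons (ccons 8 (ccons d 0)) (ccons 0 phi), k = 3,
     p = d & q = phi]).

Ltac ccons_injections := repeat match goal with
  | H : ccons _ _ = ccons _ _ |- _ => apply ccons_inj in H; destruct H
  | H : 0 = ccons _ _ |- _ => by case: (ccons_neq0 (esym H))
  | H : ccons _ _ = 0 |- _ => by case: (ccons_neq0 H)
  | H : _.+1 = _.+1 |- _ => apply succn_inj in H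
  end.

Ltac destruct_rule := repeat match goal with
  | H : _ \/ _ |- _ => destruct H
  | H : exists _, _ |- _ => destruct H
  | H : [/\ _, _ & _] |- _ => destruct H
  | H : [/\ _, _, _ & _] |- _ => destruct H
  | H : [/\ _, _, _, _ & _] |- _ => destruct H
  | H : _ /\ _ |- _ => destruct H
  end; subst; try discriminate; ccons_injections; subst.

Lemma dec_inj s t u : dec s = u -> dec t = u -> s = t.
Proof. by move=> <- /(can_inj CodeSeq.decodeK). Qed.

(** The index and the leading argument of [c] settle which rule applies. Only in kind 2 does [q]
    mention the guessed value [b], whence the proviso. For S6 and S9 the new argument list is known
    through its decoding, which is injective. *)
Lemma rule_det c k p b q k' p' b' q' :
    rule c k p b q -> rule c k' p' b' q' ->
  [/\ k = k', p = p' & k <> 2 \/ b = b' -> q = q'].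
Proof.
rewrite /rule => H H'.
destruct_rule.
all: try by split=> // -[] // ->.
all: try match goal with
| H : permuted _ _ _, H' : permuted _ _ _ |- _ =>
   move: H H' => [_ e1] [_ /(dec_inj e1) ->]
| H : truncated _ _ _, H' : truncated _ _ _ |- _ =>
   move: H H' => [_ e1] [_ /(dec_inj e1) ->]
 end; by split.
Qed.

(** The subcomputation of S8 at the number [x]: the 0 stands for [F]. *)
Definition family (p q x : nat) : nat := ccons p (ccons 0 (ccons x.+1 q)).

(* Here and below [f] represents a partial function: [0] means undefined, and
   [a.+1] means defined with value [a]. *)
Definition step (F : sem (pure 2)) (f : nat -> nat) (c a : nat) : Prop :=
  exists k p b q, rule c k p b q /\
  ((k = 0 /\ a = p) \/ (k = 1 /\ f p = a.+1) \/
   [/\ k = 2, f p = b.+1 & f q = a.+1] \/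
   [/\ k = 3, forall x, f (family p q x) <> 0 &
       a = F (fun x => (f (family p q x)).-1)]).

(** In kind 2 there is no subcomputation until [f] gives [p] a value, since [q] depends on that
    value. Such a state is not correct for [f], so it loops in [descent]. *)
Definition subcomp (f : nat -> nat) (c c' : nat) : Prop :=
  exists k p b q, rule c k p b q /\
  ((k = 1 /\ c' = p) \/ [/\ k = 2, f p = b.+1 & c' = p \/ c' = q] \/
   (k = 3 /\ exists x, c' = family p q x)).

(** The loop makes every incorrect state unfounded, so below a founded state [f] is correct
    throughout. *)
Definition descent F f c c' : Prop :=
  subcomp f c c' \/ (c' = c /\ ~ exists a, f c = a.+1 /\ step F f c a).

Definition unfounded F f c : Prop :=
  exists h : nat -> nat, h 0 = c /\ forall n, descent F f (h n) (h n.+1).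

Definition error1 F f c : Prop :=
  exists a, [/\ step F f c a, f c <> a.+1 &
    forall c', subcomp f c c' -> ~ unfounded F f c'].

Definition error2 F f c : Prop := f c <> 0 /\ unfounded F f c.

(** The second kind counts only in the absence of the first: if [f] is wrong at some subcomputation,
    a state may be unfounded for [f] although it terminates with the value that [f] gives it. *)
Definition error F f c : Prop :=
  error1 F f c \/ (~ (exists c', error1 F f c') /\ error2 F f c).

(* The premise is a partial function [h] and not the set of pairs [(c', a')] itself,
   for [step] makes sense before the relation is known to be single-valued. *)
Inductive terminating (F : sem (pure 2)) (c a : nat) : Prop :=
  Terminating h of (forall c' a', h c' = a'.+1 -> terminating F c' a') & step F h c a.

Section Machine.
Variable F : sem (pure 2).

Lemma step_det f c a b : step F f c a -> step F f c b -> a = b.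
Proof.
case=> k [p [b1 [q [r H]]]] [k' [p' [b2 [q' [r' H']]]]].
case: (rule_det r r') => ? ? e; subst k' p'.
case: H => [[? ->]|[[? H]|[[? H1 H2]|[? H1 ->]]]]; subst k;
case: H' => [[? ->]|[[? H']|[[? H1' H2']|[? H1' ->]]]] //.
- by move: H; rewrite H' => -[].
- move: H1 H1' H2 H2' => -> [] eb; rewrite e; last by right.
  by move=> -> [].
- by rewrite e //; left.
Qed.

(** The value at [c] is read off from [f] at the subcomputations alone. Hence [f] may be cut down to
    these, the only states of which an induction hypothesis speaks. *)
Lemma step_subcomp f g c a : step F f c a ->
  (forall c' a', subcomp f c c' -> f c' = a'.+1 -> g c' = a'.+1) -> step F g c a.
Proof.
case=> k [p [b [q [r H]]]] s; exists k, p, b, q; split=> //.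
have {}s c' a' : (k = 1 /\ c' = p) \/ [/\ k = 2, f p = b.+1 & c' = p \/ c' = q] \/
   (k = 3 /\ exists x, c' = family p q x) -> f c' = a'.+1 -> g c' = a'.+1.
  by move=> t; apply: s; exists k, p, b, q.
case: H => [H|[[? H]|[[? H1 H2]|[? H1 ->]]]]; first by left.
- by right; left; split=> //; apply: s => //; left.
- right; right; left; split=> //; apply: s => //; right; left; split=> //; tauto.
- have e x : g (family p q x) = f (family p q x).
    have := H1 x; case ef: (f _) => [//|n] _.
    by apply: s => //; right; right; split=> //; exists x.
  right; right; right; split=> // [x|]; first by rewrite e.
  by congr (F _); apply: funext => x; rewrite e.
Qed.

Lemma step_mono f g c a :
  (forall c' a', f c' = a'.+1 -> g c' = a'.+1) -> step F f c a -> step F g c a.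
Proof. by move=> fg /step_subcomp; apply=> c' a' _; apply: fg. Qed.

(** A rule that yields a value has used all its subcomputations. In kind 2, [h] and its extension
    [f] give [p] the same value and so lead to the same [q]. *)
Lemma subcomp_dom h f c c' a : step F h c a ->
  (forall c' a', h c' = a'.+1 -> f c' = a'.+1) -> subcomp f c c' ->
  exists a', h c' = a'.+1.
Proof.
case=> k [p [b1 [q [r H]]]] hf [k' [p' [b2 [q' [r' H']]]]].
case: (rule_det r r') => ? ? e; subst k' p'.
case: H => [[? _]|[[? H]|[[? H1 H2]|[? H1 _]]]]; subst k;
case: H' => [[? ->]|[[? H1' H2']|[? [x ->]]]] //.
- by exists a.
- move: e; have := hf _ _ H1; rewrite H1' => -[->] /(_ (or_intror erefl)) e.
  by subst q'; case: H2' => ->; [exists b1|exists a].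
- rewrite -e; last by left.
  by have := H1 x; case: (h _) => // n _; exists n.
Qed.

Lemma terminating_det c a b : terminating F c a -> terminating F c b -> a = b.
Proof.
move=> cv; elim: cv b => {}c {}a h1 _ IH s1 b [h2 H2 s2].
(* By induction the two premises agree where both are defined, so this union extends both, and
   [step_det] compares the two values over one function. *)
pose h c' := if h1 c' is 0 then h2 c' else h1 c'.
apply: (@step_det h c).
  by apply: step_mono s1 => c' a'; rewrite /h => ->.
apply: step_mono s2 => c' a' e; rewrite /h; case e1: (h1 c') => [//|a1].
by rewrite (IH _ _ e1 a') //; apply: H2.
Qed.

(** * Founded states, errors, and the unique function without error *)

Lemma founded_ind f (P : nat -> Prop) :
  (forall c, (forall c', descent F f c c' -> P c') -> P c) ->
  forall c, ~ unfounded F f c -> P c.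
Proof.
move=> IH c nb; apply: contrapT => nP; apply: nb.
(* Below a counterexample there is another one; iterating a choice of these gives an infinite
   path. *)
have nxt (x : {x | ~ P x}) : {y : {y | ~ P y} | descent F f (sval x) (sval y)}.
  apply: cid; case: x => x nPx /=; apply: contrapT => H; apply: nPx.
  by apply: IH => c' r; apply: contrapT => nPc'; apply: H; exists (exist _ c' nPc').
exists (fun n => sval (iter n (fun x => sval (nxt x)) (exist _ c nP))).
split=> // n; rewrite iterS.
by case: (nxt _).
Qed.

Lemma unfounded_next f c : unfounded F f c ->
  exists c', descent F f c c' /\ unfounded F f c'.
Proof.
case=> h [<- H]; exists (h 1); split; first exact: H.
by exists (fun n => h n.+1).
Qed.

Lemma founded_terminating f c : ~ unfounded F f c ->
  forall a, f c = a.+1 -> terminating F c a.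
Proof.
move: c; apply: founded_ind => c IH a fc.
have [[a' [fc' s]]|ns] := pselect (exists a, f c = a.+1 /\ step F f c a); last first.
  (* An incorrect state descends to itself, so the induction hypothesis holds at [c]. *)
  by apply: IH fc; right.
have -> : a = a' by move: fc'; rewrite fc => -[].
pose g c' := if `[< subcomp f c c' >] then f c' else 0.
apply: (@Terminating _ _ _ g) => [c1 a1|].
  by rewrite /g; case: asboolP => // sc; apply: IH; left.
by apply: step_subcomp s _ => c1 a1 sc; rewrite /g asboolT.
Qed.

Lemma error1_terminating f c : error1 F f c ->
  exists a, terminating F c a /\ f c <> a.+1.
Proof.
case=> a [s fc nb]; exists a; split=> //.
pose g c' := if `[< subcomp f c c' >] then f c' else 0.
apply: (@Terminating _ _ _ g) => [c1 a1|].
  by rewrite /g; case: asboolP => // /nb b; apply: (founded_terminating b).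
by apply: step_subcomp s _ => c1 a1 sc; rewrite /g asboolT.
Qed.

(** By induction on the computation, all subcomputations that [f] prescribes are founded, so a wrong
    value at [c] would be an [error1]. With the right value [c] does not loop, and every descent
    from it reaches a founded state. *)
Lemma terminating_founded f c a : (forall c, ~ error1 F f c) -> terminating F c a ->
  f c = a.+1 /\ ~ unfounded F f c.
Proof.
move=> ne; elim=> {}c {}a h _ IH s.
have hf c' a' : h c' = a'.+1 -> f c' = a'.+1 by move=> /IH [].
have sf := step_mono hf s.
have nb c' : subcomp f c c' -> ~ unfounded F f c'.
  by move=> /(subcomp_dom s hf) [a' /IH []].
have fc : f c = a.+1.
  by apply: contrapT => fc; apply: (ne c); exists a.
by split=> // /unfounded_next [c' [[/nb nb' /nb'//|[_ ns] _]]]; apply: ns; exists a.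
Qed.

Lemma error2_terminating f c a : (forall c, ~ error1 F f c) ->
  error2 F f c -> ~ terminating F c a.
Proof. by move=> ne [_ b] /(terminating_founded ne) []. Qed.

Lemma no_error_terminating f : (forall c, ~ error F f c) ->
  forall c a, f c = a.+1 <-> terminating F c a.
Proof.
move=> ne; have ne1 c : ~ error1 F f c by move=> e; apply: (ne c); left.
move=> c a; split=> [fc|/(terminating_founded ne1) []//].
apply: founded_terminating (fc) => b; apply: (ne c); right; split; first by case.
by split=> //; rewrite fc.
Qed.

Lemma error_neq f c g : (forall c a, g c = a.+1 <-> terminating F c a) ->
  error F f c ->
  f c <> g c.
Proof.
move=> gP [/error1_terminating [a [/gP -> //]]|[ne1 e2] fg].
have {}ne1 c' : ~ error1 F f c' by move=> e; apply: ne1; exists c'.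
case: (e2) => f0 _; case gc: (g c) => [|a]; first by rewrite fg gc in f0.
by case: (error2_terminating ne1 e2 (a := a)); apply/gP.
Qed.

Lemma terminating_graph :
  exists g : nat -> nat, forall c a, g c = a.+1 <-> terminating F c a.
Proof.
have P c : exists n, forall a, n = a.+1 <-> terminating F c a.
  have [[a cv]|nc] := pselect (exists a, terminating F c a).
    by exists a.+1 => b; split=> [[<-] //|/(terminating_det cv) ->].
  by exists 0 => a; split=> // cv; case: nc; exists a.
by exists (fun c => sval (cid (P c))) => c; case: (cid (P c)).
Qed.

Lemma graph_no_error g c :
  (forall c a, g c = a.+1 <-> terminating F c a) -> ~ error F g c.
Proof. by move=> gP /(error_neq gP). Qed.

(** K is the one function without error, so termination turns into an existential statement over
    functions, the form to which [Xi] applies. *)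
Lemma terminating_no_error c : (exists a, terminating F c a) <->
  exists f, (forall c, ~ error F f c) /\ f c <> 0.
Proof.
split=> [[a cv]|[f [ne fc]]].
  have [g gP] := terminating_graph; exists g; split; last by move/gP: cv => ->.
  by move=> c'; apply: graph_no_error.
case e: (f c) fc => [//|a] _; exists a.
exact/no_error_terminating.
Qed.

Lemma error_neq_no_error f c g : error F f c ->
  (forall c, ~ error F g c) -> f c <> g c.
Proof. by move=> e /no_error_terminating gP; apply: error_neq e. Qed.

Lemma no_error_unique f g : (forall c, ~ error F f c) -> (forall c, ~ error F g c) ->
  f =1 g.
Proof.
move=> /no_error_terminating fP /no_error_terminating gP c.
case ef: (f c) => [|a]; last by symmetry; apply/gP/fP.
by case eg: (g c) => [//|a]; move/gP/fP: eg; rewrite ef.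
Qed.

(** * Agreement with S1-S9 *)

Definition arg_of (n : nat) : arg := if n is x.+1 then @Arg 0 x else @Arg 2 F.

(** This and the next two are projections, with default values at the other types; they split an
    equation between dependently typed arguments into its components. *)
Definition arg_level (x : arg) : nat := let: Arg k _ := x in k.

Definition arg_num (x : arg) : nat :=
  let: Arg k X := x in
  match k return sem (pure k) -> nat with 0 => id | _ => fun=> 0 end X.

Definition arg_fun (x : arg) : sem (pure 2) :=
  let: Arg k X := x in
  match k return sem (pure k) -> sem (pure 2) with 2 => id | _ => fun=> F end X.

Lemma arg_of_num n x : @Arg 0 x = arg_of n -> n = x.+1.
Proof. by case: n => [/(congr1 arg_level)|n /(congr1 arg_num) /= ->]. Qed.

Lemma arg_of_fun n k (X : sem (pure k.+2)) : Arg X = arg_of n ->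
  n = 0 /\ Arg X = @Arg 2 F.
Proof. by case: n => [|n /(congr1 arg_level)]. Qed.

Lemma kleene_terminating e Phi a : kleene e Phi a ->
  forall s, Phi = map arg_of s -> terminating F (CodeSeq.code (e :: s)) a.
Proof.
(* With K given as a function [g], a single premise for [Terminating] serves all states, including
   the infinitely many of S8. *)
have [g gP] := terminating_graph.
suff: kleene e Phi a -> forall s, Phi = map arg_of s -> g (CodeSeq.code (e :: s)) = a.+1.
  by move=> H /H {}H s /H /gP.
have stepP c b : step F g c b -> g c = b.+1.
  by move=> st; apply/gP; apply: Terminating st => c' a' /gP.
have step0 c b q : rule c 0 b 0 q -> g c = b.+1.
  by move=> r; apply: stepP; exists 0, b, 0, q; split=> //; left.
have step1 c p q b : rule c 1 p 0 q -> g p = b.+1 -> g c = b.+1.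
  by move=> r gp; apply: stepP; exists 1, p, 0, q; split=> //; right; left.
have step2 c p b q a' : rule c 2 p b q -> g p = b.+1 -> g q = a'.+1 -> g c = a'.+1.
  by move=> r gp gq; apply: stepP; exists 2, p, b, q; split=> //; do 2 right; left.
elim=> {e Phi a} [x Phi|q Phi|x Phi|d0 d1 Phi b a _ IH1 _ IH0|d0 d1 Phi a _ IH|
  d0 d1 x Phi b a _ IH1 _ IH0|d p Phi a pp _ IH|f x Phi|k d Phi G Psi _ IH|
  x m Phi a lm _ IH] s es; rewrite -!ccons_code.
- case: s es => // n s [/arg_of_num -> _]; rewrite -ccons_code.
  by apply: (step0 _ _ 0); left; exists x, (CodeSeq.code s).
- by apply: (step0 _ _ 0); right; left; exists q, (CodeSeq.code s).
- case: s es => // n s [/arg_of_num -> _]; rewrite -ccons_code.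
  by apply: (step0 _ _ 0); do 2 right; left; exists x, (CodeSeq.code s).
- apply: (step2 _ (ccons d1 (CodeSeq.code s)) b (ccons d0 (ccons b.+1 (CodeSeq.code s)))).
  + by do 6 right; left; exists d0, d1, (CodeSeq.code s).
  + by rewrite ccons_code; apply: IH1.
  + by rewrite !ccons_code; apply: IH0; rewrite es.
- case: s es => // n s [/arg_of_num -> es]; rewrite -ccons_code.
  apply: (step1 _ (ccons d0 (CodeSeq.code s)) 0).
    by do 3 right; left; exists d0, d1, (CodeSeq.code s).
  by rewrite ccons_code; apply: IH.
- case: s es => // n s [/arg_of_num -> es]; rewrite -ccons_code.
  apply: (step2 _
    (ccons (ccons 5 (ccons d0 (ccons d1 0))) (ccons x.+1 (CodeSeq.code s))) b
    (ccons d1 (ccons x.+1 (ccons b.+1 (CodeSeq.code s))))).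
  + by do 7 right; left; exists d0, d1, x, (CodeSeq.code s).
  + by have := IH1 (x.+1 :: s); rewrite -!ccons_code es; apply.
  + by rewrite !ccons_code; apply: IH0; rewrite es.
- apply: (step1 _ (CodeSeq.code (d :: [seq nth 0 s i | i <- p])) 0).
    do 4 right; left; exists d, (CodeSeq.code p), (CodeSeq.code s).
    exists (CodeSeq.code [seq nth 0 s i | i <- p]).
    split=> //; last by rewrite ccons_code.
    by split; rewrite !CodeSeq.codeK // -(size_map arg_of) -es.
  apply: IH; rewrite -map_comp; apply/eq_in_map => i ip /=.
  rewrite es (nth_map 0) //.
  by have := perm_mem pp i; rewrite ip mem_iota es size_map.
(* S7 cannot occur, since no argument has type 1. *)
- by case: s es => // -[|n] s /(congr1 (map arg_level)).
- case: s es => // n s [/arg_of_fun [-> eF] es]; rewrite -ccons_code.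
  (* [F] is the only argument above type 0, so S8 is applied at type 2. *)
  have k0 : k = 0 by move/(congr1 arg_level): eF => -[].
  subst k; move: eF => /(congr1 arg_fun) /= eF; subst Phi.
  have {}IH x : g (family d (CodeSeq.code s) x) = (G x).+1.
    by rewrite /family !ccons_code; apply: IH; rewrite es.
  apply: stepP; exists 3, d, 0, (CodeSeq.code s); split.
    by do 8 right; exists d, (CodeSeq.code s).
  do 3 right; split=> // [x|]; first by rewrite IH.
  by congr (F _); apply: funext => x; rewrite IH.
- case: s es => // n s [/arg_of_num -> es]; rewrite -ccons_code.
  apply: (step1 _ (CodeSeq.code (x :: take m s)) 0).
    do 5 right; left; exists x, m, (CodeSeq.code s), (CodeSeq.code (take m s)).
    split=> //; last by rewrite ccons_code.
    by split; rewrite !CodeSeq.codeK // -(size_map arg_of) -es.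
  by apply: IH; rewrite es map_take.
Qed.

Lemma code1 k : ccons k 0 = CodeSeq.code [:: k].
Proof. by rewrite -ccons_code. Qed.

Lemma code2 k d : ccons k (ccons d 0) = CodeSeq.code [:: k; d].
Proof. by rewrite -!ccons_code. Qed.

Lemma code3 k d0 d1 : ccons k (ccons d0 (ccons d1 0)) = CodeSeq.code [:: k; d0; d1].
Proof. by rewrite -!ccons_code. Qed.

Lemma terminating_kleene c a : terminating F c a -> forall e phi, c = ccons e phi ->
  kleene e (map arg_of (dec phi)) a.
Proof.
elim=> {}c {}a h _ IH [k [p [b [q [r H]]]]] e phi ec; subst c.
have {}IH d psi b' : h (ccons d psi) = b'.+1 -> kleene d (map arg_of (dec psi)) b'.
  by move=> /IH; apply.
rewrite /rule in r; destruct_rule; rewrite ?dec_ccons ?code3 ?code2 ?code1 ?map_cons.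
- exact: S1.
- exact: S2.
- exact: S3.
- by apply: S5_0; apply: IH.
- match goal with H : permuted _ _ _ |- _ => case: H => pp e' end.
  (* S6 takes its permutation as a code, and every number is the code of its decoding. *)
  match goal with |- context [CodeSeq.code [:: 6; _; ?p]] =>
    rewrite -[p]CodeSeq.decodeK end.
  apply: S6; first by rewrite size_map.
  match goal with H : h _ = _ |- _ => move/IH: H; rewrite e' -map_comp end.
  congr (kleene _ _ _); apply/eq_in_map => i ip /=.
  by rewrite (nth_map 0) //; have := perm_mem pp i; rewrite ip mem_iota.
- match goal with H : truncated _ _ _ |- _ => case: H => lm e' end.
  apply: S9; first by rewrite size_map.
  by rewrite -map_take -e'; apply: IH.
- apply: S4; first by apply: IH; eassumption.
  match goal with H : h _ = a.+1 |- _ => by move/IH: H; rewrite dec_ccons end.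
- apply: S5_S.
    match goal with H : h _ = b.+1 |- _ => move/IH: H; rewrite dec_ccons code3; apply end.
  match goal with H : h _ = a.+1 |- _ => by move/IH: H; rewrite !dec_ccons end.
- apply: (@S8 0) => x'.
  match goal with H : forall x, h _ <> 0 |- _ => have := H x' end.
  case e' : (h _) => [//|n] _.
  by move/IH: e'; rewrite !dec_ccons.
Qed.

Lemma terminatesE e :
  terminates e F <-> exists a, terminating F (ccons e (ccons 0 0)) a.
Proof.
split=> -[a].
  by move=> /kleene_terminating /(_ [:: 0] erefl); rewrite -!ccons_code; exists a.
by move=> /terminating_kleene /(_ _ _ erefl); rewrite dec_ccons; exists a.
Qed.

End Machine.

(** * Closure properties of definability *)

Definition bit (P : Prop) : nat := `[< P >].

Section Definability.
Variables (Xi : sem (pure 2 ~> Nat ~> pure 1)) (mu : sem (pure 2)).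
Hypotheses (hXi : LIN Xi) (hmu : feferman_mu mu).

(** [mu] and [Xi] stay at the far end of every context, so binders come in front of them without any
    shift. Their order is that of the two outer abstractions of the final term. *)
Definition base : seq ty := [:: pure 2; (pure 2 ~> Nat ~> pure 1)%ty].

Fixpoint ecat (G : seq ty) : env G -> env (G ++ base) :=
  match G return env G -> env (G ++ base) with
  | [::] => fun=> (mu, (Xi, tt))
  | _ :: _ => fun h => (h.1, ecat h.2)
  end.

Definition definable (G : seq ty) (r : ty) (v : env G -> sem r) : Prop :=
  exists t : term (G ++ base) r, forall h, eval t (ecat h) = v h.

Definition definable_prop (G : seq ty) (P : env G -> Prop) : Prop :=
  @definable G Nat (fun h => bit (P h)).

Lemma def_ext G r (u v : env G -> sem r) : u =1 v -> definable u -> definable v.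
Proof. by move=> uv [t e]; exists t => h; rewrite e. Qed.

Lemma prop_ext G (P Q : env G -> Prop) :
  (forall h, P h <-> Q h) -> definable_prop P -> definable_prop Q.
Proof. by move=> PQ; apply: def_ext => h; congr bit; apply: propext. Qed.

Lemma def_lam G r s (v : env G -> sem (r ~> s)) :
  @definable (r :: G) s (fun h => v h.2 h.1) -> @definable G (r ~> s) v.
Proof. by case=> t e; exists (Lam t) => h; apply: funext => x; apply: (e (x, h)). Qed.

Lemma def_app G r s (u : env G -> sem (r ~> s)) (v : env G -> sem r) :
  @definable G (r ~> s) u -> definable v -> @definable G s (fun h => u h (v h)).
Proof. by case=> t e [t' e']; exists (App t t') => h /=; rewrite e e'. Qed.

Fixpoint weaken_var (G : seq ty) r (x : var G r) : var (G ++ base) r :=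
  match x with VZ _ _ => VZ _ _ | VS _ _ _ y => VS _ (weaken_var y) end.

Lemma def_lookup G r (x : var G r) : definable (lookup x).
Proof.
exists (Var (weaken_var x)) => /=; elim: x => //= {}G {}r s x IH h; exact: IH.
Qed.

Lemma def_mu G : @definable G (pure 2) (fun=> mu).
Proof.
pose fix x G : var (G ++ base) (pure 2) :=
  if G is r :: G' then VS r (x G') else VZ _ _.
by exists (Var (x G)); elim: G => //= r G IH h; apply: IH.
Qed.

Lemma def_Xi G : @definable G (pure 2 ~> Nat ~> pure 1) (fun=> Xi).
Proof.
pose fix x G : var (G ++ base) (pure 2 ~> Nat ~> pure 1) :=
  if G is r :: G' then VS r (x G') else VS _ (VZ _ _).
by exists (Var (x G)); elim: G => //= r G IH h; apply: IH.
Qed.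

Lemma def_S G (a : env G -> nat) :
  @definable G Nat a -> @definable G Nat (fun h => (a h).+1).
Proof. by case=> t e; exists (App (Succ _) t) => h /=; rewrite e. Qed.

Lemma def_nat G n : @definable G Nat (fun=> n).
Proof. by elim: n => [|n /def_S//]; exists (Zero _). Qed.

Lemma def_rec G r (a : env G -> nat) (x : env G -> sem r)
    (f : env G -> nat -> sem r -> sem r) :
  definable x -> @definable (r :: Nat :: G) r (fun h => f h.2.2 h.2.1 h.1) ->
  @definable G Nat a -> definable (fun h => nat_rect (fun=> sem r) (x h) (f h) (a h)).
Proof.
move=> [tx ex] [tf ef] [ta ea].
exists (App (App (App (Rec _ r) tx) (Lam (Lam tf))) ta) => h /=.
rewrite ex ea; congr (nat_rect _ _ _ _).
by apply: funext => n; apply: funext => y; apply: (ef (y, (n, h))).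
Qed.

Ltac def_var := first
  [ exact: (def_lookup (VZ _ _))
  | exact: (def_lookup (VS _ (VZ _ _)))
  | exact: (def_lookup (VS _ (VS _ (VZ _ _))))
  | exact: (def_lookup (VS _ (VS _ (VS _ (VZ _ _)))))
  | exact: (def_lookup (VS _ (VS _ (VS _ (VS _ (VZ _ _))))))
  | exact: (def_lookup (VS _ (VS _ (VS _ (VS _ (VS _ (VZ _ _)))))))
  | exact: (def_lookup (VS _ (VS _ (VS _ (VS _ (VS _ (VS _ (VZ _ _))))))))
  | exact: (def_lookup (VS _ (VS _ (VS _ (VS _ (VS _ (VS _ (VS _ (VZ _ _)))))))))
  | exact: (def_lookup
      (VS _ (VS _ (VS _ (VS _ (VS _ (VS _ (VS _ (VS _ (VZ _ _)))))))))) ].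

(* Substituting through an application avoids weakening terms. *)
Lemma def_sub1 G r1 s (v : env G -> sem r1 -> sem s) a1 :
  @definable (r1 :: G) s (fun h => v h.2 h.1) -> @definable G r1 a1 ->
  definable (fun h => v h (a1 h)).
Proof. by move=> /def_lam cv c1; apply: def_app c1. Qed.

Lemma def_sub2 G r1 r2 s (v : sem r1 -> sem r2 -> sem s) a1 a2 :
  @definable (r2 :: r1 :: G) s (fun h => v h.2.1 h.1) -> @definable G r1 a1 ->
  @definable G r2 a2 -> definable (fun h => v (a1 h) (a2 h)).
Proof.
move=> cv c1; apply: (@def_app G r2 s (fun h => v (a1 h))).
apply: (@def_app G r1 (r2 ~> s) (fun=> v)) c1.
by apply: def_lam; apply: def_lam.
Qed.

(** * Primitive recursive arithmetic *)

Lemma def_add G (a b : env G -> nat) : @definable G Nat a -> @definable G Nat b ->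
  @definable G Nat (fun h => a h + b h).
Proof.
move=> ca cb.
apply: def_ext (def_rec (r := Nat) (f := fun _ _ y => y.+1) cb _ ca) => [h|].
  by elim: (a h) => //= n ->.
by apply: def_S; def_var.
Qed.

Lemma def_mul G (a b : env G -> nat) : @definable G Nat a -> @definable G Nat b ->
  @definable G Nat (fun h => a h * b h).
Proof.
apply: def_sub2.
apply: (@def_ext (Nat :: Nat :: G) Nat
  (fun h => nat_rect (fun=> nat) 0 (fun _ y => h.1 + y) h.2.1)) => [h|].
- by case: h => [b0 [a0 h]] /=; elim: a0 => //= n ->; rewrite mulSn.
refine (@def_rec (Nat :: Nat :: G) Nat (fun h => h.2.1) (fun=> 0)
  (fun h _ y => h.1 + y) _ _ _).
- exact: def_nat.
- by apply: def_add; def_var.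
- by def_var.
Qed.

Lemma def_exp2 G (a : env G -> nat) : @definable G Nat a ->
  @definable G Nat (fun h => 2 ^ a h).
Proof.
move=> ca; apply: def_ext (def_rec (r := Nat)
  (x := fun=> 1) (f := fun _ _ y => y + y) _ _ ca) => [h||].
- by elim: (a h) => //= n ->; rewrite expnS mul2n addnn.
- exact: def_nat.
- by apply: def_add; def_var.
Qed.

Lemma def_ccons G (a b : env G -> nat) : @definable G Nat a -> @definable G Nat b ->
  @definable G Nat (fun h => ccons (a h) (b h)).
Proof.
move=> ca cb; apply: (@def_ext _ Nat (fun h => 2 ^ a h * (b h + b h).+1)) => [h|].
  by rewrite cconsE.
by apply: def_mul; [apply: def_exp2|apply: def_S; apply: def_add].
Qed.

Lemma def_pred G (a : env G -> nat) : @definable G Nat a ->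
  @definable G Nat (fun h => (a h).-1).
Proof.
move=> ca; apply: def_ext (def_rec (r := Nat)
  (x := fun=> 0) (f := fun _ n _ => n) _ _ ca) => [h||].
- by case: (a h).
- exact: def_nat.
- by def_var.
Qed.

Lemma def_minus G (a b : env G -> nat) : @definable G Nat a -> @definable G Nat b ->
  @definable G Nat (fun h => a h - b h).
Proof.
move=> ca cb.
apply: def_ext (def_rec (r := Nat) (f := fun _ _ y => y.-1) ca _ cb) => [h|].
  by elim: (b h) => [|n /= ->]; rewrite ?subn0 // subnS.
by apply: def_pred; def_var.
Qed.

Lemma def_ap1 G (f : env G -> nat -> nat) (a : env G -> nat) :
  @definable G (pure 1) f -> @definable G Nat a ->
  @definable G Nat (fun h => f h (a h)).
Proof. exact: def_app. Qed.

Lemma def_ap2 G (f : env G -> (nat -> nat) -> nat) (g : env G -> nat -> nat) :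
  @definable G (pure 2) f -> @definable (Nat :: G) Nat (fun h => g h.2 h.1) ->
  @definable G Nat (fun h => f h (g h)).
Proof. by move=> cf cg; apply: (@def_app G (pure 1)) cf _; apply: def_lam. Qed.

(** * Connectives and quantifiers over numbers and functions *)

Lemma prop_bit G (P : env G -> Prop) (v : env G -> nat) :
  (forall h, v h = bit (P h)) -> @definable G Nat v -> definable_prop P.
Proof. by move=> e; apply: (@def_ext G Nat v). Qed.

Lemma prop_not G (P : env G -> Prop) : definable_prop P ->
  definable_prop (fun h => ~ P h).
Proof.
move=> cP; apply: (@prop_bit _ _ (fun h => 1 - bit (P h))) => [h|].
  by rewrite /bit asbool_neg; case: `[< _ >].
by apply: def_minus cP; apply: def_nat.
Qed.

Lemma prop_and G (P Q : env G -> Prop) :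
  definable_prop P -> definable_prop Q -> definable_prop (fun h => P h /\ Q h).
Proof.
move=> cP cQ; apply: prop_bit (def_mul cP cQ) => h.
by rewrite /bit asbool_and mulnb.
Qed.

Lemma prop_or G (P Q : env G -> Prop) :
  definable_prop P -> definable_prop Q -> definable_prop (fun h => P h \/ Q h).
Proof.
move=> cP cQ; apply: prop_ext (prop_not (prop_and (prop_not cP) (prop_not cQ))) => h.
by rewrite not_andE !notK.
Qed.

Lemma prop_imp G (P Q : env G -> Prop) :
  definable_prop P -> definable_prop Q -> definable_prop (fun h => P h -> Q h).
Proof.
move=> cP cQ; apply: prop_ext (prop_or (prop_not cP) cQ) => h.
by split=> [[]//|PQ]; have [p|] := pselect (P h); [right; apply: PQ|left].
Qed.

Lemma prop_and3 G (P Q R : env G -> Prop) :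
  definable_prop P -> definable_prop Q -> definable_prop R ->
  definable_prop (fun h => [/\ P h, Q h & R h]).
Proof.
move=> cP cQ cR; apply: prop_ext (prop_and cP (prop_and cQ cR)) => h.
by split=> [[p []]|[]].
Qed.

Lemma prop_and4 G (P Q R S : env G -> Prop) :
  definable_prop P -> definable_prop Q -> definable_prop R -> definable_prop S ->
  definable_prop (fun h => [/\ P h, Q h, R h & S h]).
Proof.
move=> cP cQ cR cS; apply: prop_ext (prop_and cP (prop_and3 cQ cR cS)) => h.
by split=> [[p []]|[]].
Qed.

Lemma prop_and5 G (P Q R S T : env G -> Prop) :
  definable_prop P -> definable_prop Q -> definable_prop R -> definable_prop S ->
  definable_prop T ->
  definable_prop (fun h => [/\ P h, Q h, R h, S h & T h]).
Proof.
move=> cP cQ cR cS cT; apply: prop_ext (prop_and cP (prop_and4 cQ cR cS cT)) => h.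
by split=> [[p []]|[]].
Qed.

Lemma prop_eq G (a b : env G -> nat) : @definable G Nat a -> @definable G Nat b ->
  definable_prop (fun h => a h = b h).
Proof.
move=> ca cb.
apply: (@prop_bit _ _ (fun h => 1 - ((a h - b h) + (b h - a h)))) => [h|].
  rewrite /bit (_ : `[< _ >] = (a h == b h)); last by apply/asboolP/eqP.
  case: ltngtP => [ab|ba|->]; last by rewrite subnn.
  - by move: ab; rewrite -subn_gt0; case: (b h - a h) => // n _; rewrite addnS.
  - by move: ba; rewrite -subn_gt0; case: (a h - b h) => // n _; rewrite addSn.
by apply: def_minus; [apply: def_nat|apply: def_add; apply: def_minus].
Qed.

Lemma prop_leq G (a b : env G -> nat) : @definable G Nat a -> @definable G Nat b ->
  definable_prop (fun h => a h <= b h).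
Proof.
move=> ca cb; apply: prop_ext (prop_eq (def_minus ca cb) (def_nat G 0)) => h.
by rewrite /leq; split=> /eqP.
Qed.

(** [mu] looks for zeros, hence the complement of [bit]. The result is arbitrary if [P] holds
    nowhere. *)
Definition mu_pick (P : nat -> Prop) : nat := mu (fun n => 1 - bit (P n)).

Lemma mu_pickP (P : nat -> Prop) : (exists n, P n) -> P (mu_pick P).
Proof.
move=> [n Pn]; have /hmu : exists n, 1 - bit (P n) = 0.
  by exists n; rewrite /bit asboolT.
by rewrite -/(mu_pick P) /bit; case: asboolP.
Qed.

Lemma def_mu_pick G (P : env G -> nat -> Prop) :
  @definable_prop (Nat :: G) (fun h => P h.2 h.1) ->
  @definable G Nat (fun h => mu_pick (P h)).
Proof.
move=> cP; apply: (@def_ap2 G (fun=> mu) (fun h n => 1 - bit (P h n)) (def_mu G)).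
by apply: def_minus cP; apply: def_nat.
Qed.

(** If there is a witness at all, [mu_pick] gives one, so it is enough to test [P] there. *)
Lemma prop_ex G (P : env G -> nat -> Prop) :
  @definable_prop (Nat :: G) (fun h => P h.2 h.1) ->
  definable_prop (fun h => exists n, P h n).
Proof.
move=> cP; apply: (@prop_ext _ (fun h => P h (mu_pick (P h)))) => [h|].
  by split=> [p|/mu_pickP //]; exists (mu_pick (P h)).
exact: (def_sub1 (r1 := Nat) (s := Nat) (v := fun h n => bit (P h n))) cP (def_mu_pick cP).
Qed.

Lemma prop_all G (P : env G -> nat -> Prop) :
  @definable_prop (Nat :: G) (fun h => P h.2 h.1) ->
  definable_prop (fun h => forall n, P h n).
Proof.
move=> cP; apply: prop_ext (prop_not (prop_ex (P := fun h n => ~ P h n) (prop_not cP)))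
  => h.
split=> [ne n|a [n]]; last by apply.
by apply: contrapT => nP; apply: ne; exists n.
Qed.

(** [mu] recovers the value from the graph, so a function on codes need only be described by a
    formula. *)
Lemma def_graph G (v : env G -> nat) :
  @definable_prop (Nat :: G) (fun h => v h.2 = h.1) -> @definable G Nat v.
Proof.
move=> cP; apply: def_ext (def_mu_pick (P := fun h n => v h = n) cP) => h.
by have := mu_pickP (ex_intro (fun n => v h = n) _ erefl).
Qed.

(* [m] is a modulus for the complement of [P h], so a neighbourhood in the covering
   that [Xi] finds for [m h] contains an element of [P h] only if its centre is one. *)
Lemma prop_exists_fun G (P : env G -> (nat -> nat) -> Prop)
    (m : env G -> (nat -> nat) -> nat) :
  (forall h f g, P h g -> (forall i, i < m h f -> f i = g i) -> P h f) ->
  @definable_prop (pure 1 :: G) (fun h => P h.2 h.1) ->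
  @definable (pure 1 :: G) Nat (fun h => m h.2 h.1) ->
  definable_prop (fun h => exists f, P h f).
Proof.
move=> mP cP cm.
apply: (@prop_ext _ (fun h => exists n, P h (Xi (m h) n))) => [h|].
  split=> [[n Pn]|[g Pg]]; first by exists (Xi (m h) n).
  have [n] := hXi (m h) g; rewrite /nbhd size_mkseq => e; exists n.
  apply: mP Pg _ => i lt; have := congr1 (fun s => nth 0 s i) e.
  by rewrite !nth_mkseq.
apply: (@prop_ext _ (fun h => exists n, bit (P h (Xi (m h) n)) = 1)) => [h|].
  by split=> -[n e]; exists n; move: e; rewrite /bit; case: asboolP.
(* [P h] and [m h] become the variables [p] and [k], so that their terms need not be moved under the
   quantifier over [n]. *)
apply: (@def_sub2 G (pure 1 ~> Nat) (pure 2) Nat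
  (fun p k => bit (exists n, p (Xi k n) = 1)) (fun h f => bit (P h f)) m).
- apply: prop_ex; apply: prop_eq; last exact: def_nat.
  pose D := Nat :: pure 2 :: (pure 1 ~> Nat)%ty :: G.
  refine (@def_app D (pure 1) Nat (fun h => h.2.2.1) (fun h => Xi h.2.1 h.1) _ _).
    by def_var.
  refine (@def_app D Nat (pure 1) (fun h => Xi h.2.1) (fun h => h.1) _ _).
    refine (@def_app D (pure 2) (Nat ~> pure 1) (fun=> Xi) (fun h => h.2.1) _ _).
      exact: def_Xi.
    by def_var.
  by def_var.
- exact: def_lam.
- exact: def_lam.
Qed.

Lemma prop_sub3 G r1 r2 r3 (P : sem r1 -> sem r2 -> sem r3 -> Prop) a1 a2 a3 :
  @definable_prop (r3 :: r2 :: r1 :: G) (fun h => P h.2.2.1 h.2.1 h.1) ->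
  @definable G r1 a1 -> @definable G r2 a2 -> @definable G r3 a3 ->
  definable_prop (fun h => P (a1 h) (a2 h) (a3 h)).
Proof.
move=> cP c1 c2; apply: (@def_app G r3 Nat (fun h x => bit (P (a1 h) (a2 h) x))).
apply: (@def_sub2 G r1 r2 (r3 ~> Nat) (fun x y z => bit (P x y z))) c1 c2.
exact: def_lam.
Qed.

Lemma prop_sub4 G r1 r2 r3 r4 (P : sem r1 -> sem r2 -> sem r3 -> sem r4 -> Prop)
    a1 a2 a3 a4 :
  @definable_prop (r4 :: r3 :: r2 :: r1 :: G) (fun h => P h.2.2.2.1 h.2.2.1 h.2.1 h.1) ->
  @definable G r1 a1 -> @definable G r2 a2 -> @definable G r3 a3 ->
  @definable G r4 a4 ->
  definable_prop (fun h => P (a1 h) (a2 h) (a3 h) (a4 h)).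
Proof.
move=> cP c1 c2 c3.
apply: (@def_app G r4 Nat (fun h x => bit (P (a1 h) (a2 h) (a3 h) x))).
apply: (@def_app G r3 (r4 ~> Nat) (fun h x y => bit (P (a1 h) (a2 h) x y))) c3.
apply: (@def_sub2 G r1 r2 (r3 ~> r4 ~> Nat) (fun x y z t => bit (P x y z t))) c1 c2.
by do 2 apply: def_lam.
Qed.

Lemma prop_sub5 G r1 r2 r3 r4 r5
    (P : sem r1 -> sem r2 -> sem r3 -> sem r4 -> sem r5 -> Prop) a1 a2 a3 a4 a5 :
  @definable_prop (r5 :: r4 :: r3 :: r2 :: r1 :: G)
    (fun h => P h.2.2.2.2.1 h.2.2.2.1 h.2.2.1 h.2.1 h.1) ->
  @definable G r1 a1 -> @definable G r2 a2 -> @definable G r3 a3 ->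
  @definable G r4 a4 ->
  @definable G r5 a5 ->
  definable_prop (fun h => P (a1 h) (a2 h) (a3 h) (a4 h) (a5 h)).
Proof.
move=> cP c1 c2 c3 c4.
apply: (@def_app G r5 Nat (fun h x => bit (P (a1 h) (a2 h) (a3 h) (a4 h) x))).
apply: (@def_app G r4 (r5 ~> Nat)
  (fun h x y => bit (P (a1 h) (a2 h) (a3 h) x y))) c4.
apply: (@def_app G r3 (r4 ~> r5 ~> Nat)
  (fun h x y z => bit (P (a1 h) (a2 h) x y z))) c3.
apply: (@def_sub2 G r1 r2 (r3 ~> r4 ~> r5 ~> Nat)
  (fun x y z t u => bit (P x y z t u))) c1 c2.
by do 3 apply: def_lam.
Qed.

Ltac def_core := lazymatch goal with
  | |- definable_prop (fun h => @?P h /\ @?Q h) => apply: prop_and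
  | |- definable_prop (fun h => [/\ @?P h, @?Q h & @?R h]) => apply: prop_and3
  | |- definable_prop (fun h => [/\ @?P h, @?Q h, @?R h & @?S h]) => apply: prop_and4
  | |- definable_prop (fun h => [/\ @?P h, @?Q h, @?R h, @?S h & @?T h]) => apply: prop_and5
  | |- definable_prop (fun h => @?P h \/ @?Q h) => apply: prop_or
  | |- definable_prop (fun h => ~ @?P h) => apply: prop_not
  | |- definable_prop (fun h => @?a h = @?b h) => apply: prop_eq
  | |- definable_prop (fun h => is_true (@?a h <= @?b h)) => apply: prop_leq
  | |- definable_prop (fun h => exists n : nat, @?P h n) => apply: prop_ex
  | |- definable_prop (fun h => forall n : nat, @?P h n) => apply: prop_all
  | |- definable_prop (fun h => @?P h -> @?Q h) => apply: prop_imp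
  | |- definable fst => def_var
  | |- definable (fun h => fst (@?a h)) => def_var
  | |- definable (fun h => S (@?a h)) => apply: def_S
  | |- definable (fun h => @?a h + @?b h) => apply: def_add
  | |- definable (fun h => ccons (@?a h) (@?b h)) => apply: def_ccons
  | |- definable (fun h => (@?a h).-1) => apply: def_pred
  | |- @definable ?G _ (fun h => fst (@?p h) (fun x => @?b h x)) =>
      refine (@def_ap2 G (fun h => fst (p h)) b _ _); cbv beta
  | |- @definable ?G _ (fun h => fst (@?p h) (@?a h)) =>
      refine (@def_ap1 G (fun h => fst (p h)) a _ _); cbv beta
  | |- definable _ => exact: def_nat
  end.

(** * Lists coded by numbers *)

Definition chead (c : nat) : nat := head 0 (dec c).
Definition cbehead (c : nat) : nat := CodeSeq.code (behead (dec c)).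
Definition cdrop (c i : nat) : nat := nat_rect (fun=> nat) c (fun=> cbehead) i.

Lemma dec_eq0 c : dec c = [::] <-> c = 0.
Proof. by split=> [/(congr1 CodeSeq.code)|->//]; rewrite CodeSeq.decodeK. Qed.

Lemma dec_cdrop c i : dec (cdrop c i) = drop i (dec c).
Proof.
elim: i => [|i IH] /=; first by rewrite drop0.
by rewrite /cbehead CodeSeq.codeK IH -[i.+1]add1n -drop_drop drop1.
Qed.

Lemma cconsP c : c <> 0 -> exists x d, c = ccons x d.
Proof.
move=> c0; case e: (dec c) => [|x s]; first by move/dec_eq0: e.
by exists x, (CodeSeq.code s); rewrite ccons_code -e CodeSeq.decodeK.
Qed.

Lemma def_head G a : @definable G Nat a -> @definable G Nat (fun h => chead (a h)).
Proof.
apply: (@def_sub1 G Nat Nat (fun=> chead)); apply: def_graph.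
apply: (@prop_ext (Nat :: Nat :: G)
  (fun h => (h.2.1 = 0 /\ h.1 = 0) \/ exists d, h.2.1 = ccons h.1 d)).
  move=> [x [c h]] /=; split=> [[[-> ->]//|[d ->]]|<-].
    by rewrite /chead dec_ccons.
  have [->|/cconsP [y [d ->]]] := pselect (c = 0); first by left.
  by right; exists d; rewrite /chead dec_ccons.
by repeat def_core.
Qed.

Lemma def_behead G a : @definable G Nat a ->
  @definable G Nat (fun h => cbehead (a h)).
Proof.
apply: (@def_sub1 G Nat Nat (fun=> cbehead)); apply: def_graph.
apply: (@prop_ext (Nat :: Nat :: G)
  (fun h => (h.2.1 = 0 /\ h.1 = 0) \/ exists x, h.2.1 = ccons x h.1)).
  move=> [d [c h]] /=; split=> [[[-> ->]//|[x ->]]|<-].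
    by rewrite /cbehead dec_ccons /= CodeSeq.decodeK.
  have [->|/cconsP [y [d' ->]]] := pselect (c = 0); first by left.
  by right; exists y; rewrite /cbehead dec_ccons /= CodeSeq.decodeK.
by repeat def_core.
Qed.

Lemma def_drop G a b : @definable G Nat a -> @definable G Nat b ->
  @definable G Nat (fun h => cdrop (a h) (b h)).
Proof.
move=> ca cb; apply: (@def_rec G Nat b a (fun _ _ => cbehead)) => //.
by apply: def_behead; def_var.
Qed.

Lemma def_nth G a b : @definable G Nat a -> @definable G Nat b ->
  @definable G Nat (fun h => nth 0 (dec (a h)) (b h)).
Proof.
move=> ca cb; apply: def_ext (def_head (def_drop ca cb)) => h.
by rewrite /chead dec_cdrop -nth0 nth_drop addn0.
Qed.

Lemma def_size G a : @definable G Nat a ->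
  @definable G Nat (fun h => size (dec (a h))).
Proof.
apply: (@def_sub1 G Nat Nat (fun=> (fun c => size (dec c)))); apply: def_graph.
(* The size is the least number of deletions that leave the empty list, which has code 0. *)
apply: (@prop_ext (Nat :: Nat :: G) (fun h => cdrop h.2.1 h.1 = 0 /\
  forall n, n < h.1 -> cdrop h.2.1 n <> 0)).
  move=> [n [c h]] /=.
  have E i : cdrop c i = 0 <-> size (dec c) <= i.
    rewrite -dec_eq0 dec_cdrop -subn_eq0 -size_drop.
    by split=> [->//|]; case: (drop _ _).
  split=> [[/E le lt]|<-].
    apply/eqP; rewrite eqn_leq le leqNgt; apply/negP => /lt; apply.
    exact/E.
  by split=> [|i lt /E]; [apply/E|rewrite leqNgt lt].
apply: prop_and.
  by apply: prop_eq; [apply: def_drop; def_var|apply: def_nat].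
apply: prop_all; apply: prop_imp; first by repeat def_core.
by apply: prop_not; apply: prop_eq; [apply: def_drop; def_var|apply: def_nat].
Qed.

(** An arithmetical form: by counting, a list with as many entries as there are positions, among
    which every position occurs, has no repetition and so is a permutation. *)
Lemma permutedE p phi phi' : permuted p phi phi' <->
  [/\ size (dec p) = size (dec phi),
   forall i, i < size (dec phi) -> exists j, j < size (dec p) /\ nth 0 (dec p) j = i,
   size (dec phi') = size (dec p) &
   forall i, i < size (dec p) -> nth 0 (dec phi') i = nth 0 (dec phi) (nth 0 (dec p) i)].
Proof.
split=> [[pe e]|[sz H sz' H']].
  have st := perm_size pe; rewrite size_iota in st.
  split=> // [i lt||i lt]; last 2 first.
  - by rewrite e size_map.
  - by rewrite e (nth_map 0).
  have : i \in dec p by rewrite (perm_mem pe) mem_iota.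
  by move=> /(nthP 0) [j ltj <-]; exists j.
split; last first.
  apply: (@eq_from_nth _ 0); rewrite ?size_map // sz' => i lt.
  by rewrite (nth_map 0) ?H'.
have sub_sp : {subset iota 0 (size (dec phi)) <= dec p}.
  by move=> i; rewrite mem_iota /= => /H [j [ltj <-]]; apply: mem_nth.
have le : size (dec p) <= size (iota 0 (size (dec phi))) by rewrite size_iota sz.
have [_ eqm] := uniq_min_size (iota_uniq _ _) sub_sp le.
apply: uniq_perm (iota_uniq _ _) _; last by move=> i; rewrite eqm.
by rewrite (eq_uniq (s2 := iota 0 (size (dec phi)))) ?iota_uniq // size_iota.
Qed.

Lemma truncatedE m phi phi' : truncated m phi phi' <->
  [/\ m <= size (dec phi), size (dec phi') = m &
   forall i, i < m -> nth 0 (dec phi') i = nth 0 (dec phi) i].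
Proof.
split=> [[le e]|[le sz H]].
  split=> // [|i lt]; rewrite e ?size_takel ?nth_take //.
split=> //; apply: (@eq_from_nth _ 0); rewrite ?size_takel // sz => i lt.
by rewrite nth_take ?H.
Qed.

Ltac def_lists := lazymatch goal with
  | |- definable (fun h => nth _ (@?a h) (@?b h)) => apply: def_nth
  | |- definable (fun h => size (@?a h)) => apply: def_size
  | _ => def_core
  end.

(** * Definability of the superjump *)

Lemma prop_permuted G a b c : @definable G Nat a -> @definable G Nat b ->
  @definable G Nat c ->
  definable_prop (fun h => permuted (a h) (b h) (c h)).
Proof.
apply: (@prop_sub3 G Nat Nat Nat permuted).
apply: prop_ext (fun h => iff_sym (permutedE _ _ _)) _.
by repeat def_lists.
Qed.

Lemma prop_truncated G a b c : @definable G Nat a -> @definable G Nat b ->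
  @definable G Nat c ->
  definable_prop (fun h => truncated (a h) (b h) (c h)).
Proof.
apply: (@prop_sub3 G Nat Nat Nat truncated).
apply: prop_ext (fun h => iff_sym (truncatedE _ _ _)) _.
by repeat def_lists.
Qed.

Ltac def_codes := lazymatch goal with
  | |- definable_prop (fun h => permuted (@?a h) (@?b h) (@?c h)) => apply: prop_permuted
  | |- definable_prop (fun h => truncated (@?a h) (@?b h) (@?c h)) => apply: prop_truncated
  | _ => def_lists
  end.

Lemma prop_rule G a b c d e : @definable G Nat a -> @definable G Nat b ->
  @definable G Nat c ->
  @definable G Nat d -> @definable G Nat e ->
  definable_prop (fun h => rule (a h) (b h) (c h) (d h) (e h)).
Proof.
apply: (@prop_sub5 G Nat Nat Nat Nat Nat rule).
rewrite /rule.
by repeat def_codes.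
Qed.

Lemma prop_step G u f a b : @definable G (pure 2) u -> @definable G (pure 1) f ->
  @definable G Nat a -> @definable G Nat b ->
  definable_prop (fun h => step (u h) (f h) (a h) (b h)).
Proof.
apply: (@prop_sub4 G (pure 2) (pure 1) Nat Nat step).
rewrite /step /family.
by repeat first [def_core | apply: prop_rule].
Qed.

Lemma prop_subcomp G f a b : @definable G (pure 1) f ->
  @definable G Nat a -> @definable G Nat b ->
  definable_prop (fun h => subcomp (f h) (a h) (b h)).
Proof.
apply: (@prop_sub3 G (pure 1) Nat Nat subcomp).
rewrite /subcomp /family.
by repeat first [def_core | apply: prop_rule].
Qed.

Lemma prop_descent G u f a b : @definable G (pure 2) u -> @definable G (pure 1) f ->
  @definable G Nat a -> @definable G Nat b ->
  definable_prop (fun h => descent (u h) (f h) (a h) (b h)).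
Proof.
apply: (@prop_sub4 G (pure 2) (pure 1) Nat Nat descent).
rewrite /descent.
by repeat first [def_core | apply: prop_step | apply: prop_subcomp].
Qed.

Lemma prop_unfounded G u f a : @definable G (pure 2) u -> @definable G (pure 1) f ->
  @definable G Nat a -> definable_prop (fun h => unfounded (u h) (f h) (a h)).
Proof.
apply: (@prop_sub3 G (pure 2) (pure 1) Nat unfounded).
pose P (F : sem (pure 2)) f (h : nat -> nat) n := ~ descent F f (h n) (h n.+1).
(* If the path [h] breaks between [n] and [n.+1], its first [n + 2] values show this. The modulus is
   always positive, so the condition on [h 0] is covered too. *)
refine (@prop_exists_fun [:: Nat, pure 1, pure 2 & G]
  (fun x h => h 0 = x.1 /\ forall n, descent x.2.2.1 x.2.1 (h n) (h n.+1))
  (fun x h => (mu_pick (P x.2.2.1 x.2.1 h)).+2) _ _ _).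
- move=> [c [f0 [F x]]] h g /= [g0 gr] hg; split; first by rewrite hg.
  move=> n; apply: contrapT => nr.
  have := mu_pickP (ex_intro (P F f0 h) n nr).
  by rewrite !hg // => /(_ (gr _)).
- by repeat first [def_core | apply: prop_descent].
- do 2 apply: def_S; apply: def_mu_pick; rewrite /P.
  by repeat first [def_core | apply: prop_descent].
Qed.

Lemma prop_error G u f a : @definable G (pure 2) u -> @definable G (pure 1) f ->
  @definable G Nat a -> definable_prop (fun h => error (u h) (f h) (a h)).
Proof.
apply: (@prop_sub3 G (pure 2) (pure 1) Nat error).
rewrite /error /error1 /error2.
by repeat first
  [def_core | apply: prop_step | apply: prop_subcomp | apply: prop_unfounded].
Qed.

Lemma def_superjump : @definable [::] (pure 2 ~> Nat ~> Nat) (fun=> superjump).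
Proof.
do 2 apply: def_lam.
pose P F e (f : nat -> nat) := (forall c, ~ error F f c) /\ f (ccons e (ccons 0 0)) <> 0.
apply: (@def_ext [:: Nat; pure 2] Nat
  (fun h => 1 - bit (exists f, P h.2.1 h.1 f))) => [[e [F []]]|].
  rewrite /superjump /bit /=.
  have -> : (exists f, P F e f) = terminates e F.
    by apply: propext; rewrite terminatesE terminating_no_error.
  by case: asboolP.
apply: def_minus; first exact: def_nat.
(* The modulus reaches just past a state where [f] has an error, if there is one. A function without
   error differs from [f] at that state, so it cannot agree with [f] below the modulus. If [f] has
   no error, uniqueness carries over the value at the initial state. *)
apply: (@prop_exists_fun [:: Nat; pure 2] (fun h => P h.2.1 h.1)
  (fun h f => (mu_pick (error h.2.1 f)).+1)).
- move=> [e [F x]] f g /= [ng gN] fg.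
  have [[c ec]|nf] := pselect (exists c, error F f c).
    have := mu_pickP (ex_intro (error F f) c ec) => /error_neq_no_error /(_ ng).
    by rewrite fg.
  have {}nf c : ~ error F f c by move=> ec; apply: nf; exists c.
  by split=> //; rewrite (no_error_unique nf ng).
- by rewrite /P; repeat first [def_core | apply: prop_error].
- apply: def_S; apply: def_mu_pick.
  by repeat first [def_core | apply: prop_error].
Qed.

End Definability.

Theorem corollary4p15 (Xi : sem (pure 2 ~> Nat ~> pure 1)) (mu : sem (pure 2))
    (hXi : LIN Xi) (hmu : feferman_mu mu) :
  T_computable_in (r := pure 2 ~> Nat ~> pure 1) (s := pure 2)
    (u := pure 2 ~> Nat ~> Nat) superjump Xi mu.
Proof.
have [t e] := def_superjump hXi hmu.
by exists (Lam (Lam t)); rewrite -(e tt).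
Qed.
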